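(* Let $p$ be a prime and let $A,\Gamma\subset\mathbb{F}_p^*$ be two multiplicative subgroups. Suppose that $A-A=\xi\Gamma\sqcup\{0\}$ for some $\xi\in\mathbb{F}_p^*$, and that $(A\circ A)(x)=c$ is a constant for all $x\in\xi\Gamma$. Then $|A|^2-|A|=c|\Gamma|$, and either $|\Gamma|=O(1)$ or $|\Gamma|\gg\frac{p}{\log p}$.
   Context: For a set $A\subseteq\mathbb{F}_p$ (identified with its indicator function), $(A\circ A)(x)=\sum_{y\in\mathbb{F}_p}A(y)A(y+x)=|\{(a,a')\in A^2: a'-a=x\}|$. $X\ll Y$ means $X\le cY$ with an absolute constant $c$. *)

(* Defs.v *)
From Stdlib Require Import Reals.
From mathcomp Require Import all_boot all_order all_algebra.
Set Implicit Arguments. Unset Strict Implicit. Unset Printing Implicit Defensive.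
Import GRing.Theory.
Local Open Scope ring_scope.


Section Defs.
Variable F : finFieldType.

Definition is_mult_subgroup (A : {set F}) : bool :=
  [&& (0 \notin A), (1 \in A),
      [forall x in A, forall y in A, x * y \in A] &
      [forall x in A, x^-1 \in A]].

Definition diffset (A : {set F}) : {set F} := [set x - y | x in A, y in A].

Definition dilate (xi : F) (G : {set F}) : {set F} := [set xi * g | g in G].

Definition conv (A : {set F}) (x : F) : nat := #|[set y in A | y + x \in A]|.
End Defs.

(* Main.v *)
(** Write [n = #|A|], [d = #|Gam|] and [kappa = xi ^+ d], so that
    [(a - b) ^+ d = kappa] for distinct [a], [b] in [A].  If [Gam] is proper then
    [d + n <= p], and Stepanov's method (in the form of Hanson and Petridis) applies:
    [\sum_(a in A) a (a - X)^(d + n - 1) - n kappa] is a nonzero polynomial of degree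
    at most [d] divisible by [(X^n - 1)^(n - 1)].  Hence [n (n - 1) <= d], so
    [c = 1], [d = n (n - 1)], and the two polynomials are proportional.

    For [n > 3], [c = 1] forces [n] to be odd, and comparing coefficients gives
    ['C(n^2 - 1, n k) = mu 'C(n - 1, k)] mod [p] for [0 < k < n].  Ratios of consecutive
    coefficients show that [\prod_(0 < i < n) (u + i)] and
    [\prod_(0 < i < n) (u + i - n^2)] agree at [u = n k] for [0 < k < n - 1],
    which determines their difference to be
    [n^2 (n - 1) \prod_(0 < k < n - 1) (u - n k)].  Two degrees below the leading term
    this identity reads [n^3 (n - 1)^2 (n - 2) (n - 3) (n + 1)^2 = 0] mod [p], which is
    impossible.  So [n <= 3] and [d <= 6], unless [Gam] is the whole of [F_p^*]. *)
Require Import Defs.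
From Stdlib Require Import Reals Lra.
From mathcomp Require Import all_boot all_order all_algebra.
From mathcomp Require Import finfield ring zify.
Set Implicit Arguments. Unset Strict Implicit. Unset Printing Implicit Defensive.
Import GRing.Theory.
Local Open Scope ring_scope.

(** * Multiplicative subgroups: Lagrange, roots of unity, power sums *)

Section Subgroup.
Variables (F : finFieldType) (A : {set F}).
Hypothesis sgA : is_mult_subgroup A.

Lemma subgroup1 : 1 \in A.
Proof. by case/and4P: sgA. Qed.

Lemma subgroup_neq0 x : x \in A -> x != 0.
Proof. by case/and4P: sgA => A0 _ _ _ Ax; apply: contraNneq A0 => <-. Qed.

Lemma subgroupM x y : x \in A -> y \in A -> x * y \in A.
Proof.
by case/and4P: sgA => _ _ /forall_inP AM _ Ax Ay; move/forall_inP: (AM x Ax); apply.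
Qed.

Lemma card_subgroup_gt0 : (0 < #|A|)%N.
Proof. by apply/card_gt0P; exists 1; exact: subgroup1. Qed.

Lemma subgroup_translate b : b \in A -> [set b * x | x in A] = A.
Proof.
move=> Ab; apply/eqP; rewrite eqEcard; apply/andP; split.
  by apply/subsetP => _ /imsetP[x Ax ->]; exact: subgroupM.
by rewrite card_imset //; exact/mulfI/subgroup_neq0.
Qed.

Lemma subgroup_big (R : Type) (idx : R) (op : Monoid.com_law idx) (f : F -> R) b :
  b \in A -> \big[op/idx]_(x in A) f x = \big[op/idx]_(x in A) f (b * x).
Proof.
move=> Ab; rewrite -{1}(subgroup_translate Ab) big_imset //.
by move=> x y _ _; exact/mulfI/subgroup_neq0.
Qed.

(** Multiplication by [x] permutes [A], so the nonzero product of all elements of [A] equals itself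
    times [x ^+ #|A|]. *)
Lemma subgroup_expg x : x \in A -> x ^+ #|A| = 1.
Proof.
move=> Ax; have := subgroup_big *%R id Ax.
rewrite big_split /= prodr_const => /esym /(canRL (mulfK _)) -> //.
  by rewrite divff //; apply/prodf_neq0 => y /subgroup_neq0.
by apply/prodf_neq0 => y /subgroup_neq0.
Qed.

Lemma subgroup_prod_XsubC : 'X^#|A| - 1 = \prod_(a in A) ('X - a%:P).
Proof.
have n0 := card_subgroup_gt0.
rewrite (@all_roots_prod_XsubC _ ('X^#|A| - 1) (enum A)) ?big_enum /=.
- rewrite (_ : lead_coef _ = 1) ?scale1r //.
  by rewrite lead_coefE size_Xn_sub_1 //= coefB coefXn coef1 eqxx gtn_eqF ?subr0.
- by rewrite size_Xn_sub_1 // cardE.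
- apply/allP => a; rewrite mem_enum => Aa.
  by rewrite rootE !hornerE subgroup_expg // subrr.
- by rewrite uniq_rootsE enum_uniq.
Qed.

Lemma subgroup_mem x : x ^+ #|A| = 1 -> x \in A.
Proof.
move=> xn; have : ('X^#|A| - 1).[x] == 0 by rewrite !hornerE xn subrr.
rewrite subgroup_prod_XsubC horner_prod prodf_seq_eq0.
by case/hasP => a _ /andP[Aa]; rewrite !hornerE subr_eq0 => /eqP->.
Qed.

(** By Bezout every element of [A] is a root of [X^g - 1] with [g = gcdn #|A| m]. Counting roots
    gives [#|A| <= g], so no appeal to cyclicity is made. *)
Lemma subgroup_expg_gcd m :
  (forall x, x \in A -> x ^+ m = 1) -> (0 < m)%N -> (#|A| %| m)%N.
Proof.
move=> Am m0; have g0 : (0 < gcdn #|A| m)%N by rewrite gcdn_gt0 m0 orbT.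
have : (#|A| <= gcdn #|A| m)%N.
  rewrite {1}cardE -ltnS -(size_Xn_sub_1 F g0); apply: max_poly_roots.
  - by rewrite -size_poly_gt0 size_Xn_sub_1.
  - apply/allP => x; rewrite mem_enum => Ax.
    rewrite rootE !hornerE subr_eq0.
    case: (egcdnP m card_subgroup_gt0) => u v uv _.
    have : x ^+ (u * #|A|) = x ^+ (v * m + gcdn #|A| m) by rewrite uv.
    rewrite exprD mulnC exprM subgroup_expg // mulnC exprM Am // !expr1n mul1r.
    by move=> <-.
  - exact: enum_uniq.
move=> le; suff <- : gcdn #|A| m = #|A| by exact: dvdn_gcdr.
by apply/eqP; rewrite eqn_leq le dvdn_leq ?dvdn_gcdl ?card_subgroup_gt0.
Qed.

(** If some [b] in [A] has [b ^+ k != 1], translating by [b] multiplies the sum by [b ^+ k], so the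
    sum vanishes. Otherwise every [k]-th power is 1 and [#|A|] divides [k]. *)
Lemma subgroup_power_sum k :
  \sum_(a in A) a ^+ k = if (#|A| %| k)%N then #|A|%:R else 0.
Proof.
case: ifP => [/dvdnP[q ->]|ndvd].
  under eq_bigr => a Aa do rewrite mulnC exprM subgroup_expg // expr1n.
  by rewrite sumr_const.
have [/forall_inP Ak|] := boolP [forall x in A, x ^+ k == 1].
  case: k ndvd Ak => [|k]; first by rewrite dvdn0.
  by move=> nd Ak; rewrite subgroup_expg_gcd // in nd => x /Ak/eqP.
case/forall_inPn => b Ab bk.
have := subgroup_big +%R (fun x => x ^+ k) Ab.
under [X in _ = X]eq_bigr => a _ do rewrite exprMn.
rewrite -mulr_sumr -{1}[\sum_(_ in _) _]mul1r => /eqP.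
by rewrite -subr_eq0 -mulrBl mulf_eq0 subr_eq0 eq_sym (negPf bk) => /eqP.
Qed.

Lemma card_subgroup_dvd : (#|A| %| #|F|.-1)%N.
Proof.
have F1 : (1 < #|F|)%N := finNzRing_gt1 F.
apply: subgroup_expg_gcd => [x Ax|]; last by rewrite -subn1 subn_gt0.
apply: (mulfI (subgroup_neq0 Ax)).
by rewrite -exprS prednK ?expf_card ?mulr1 // ltnW.
Qed.

Lemma subgroup_opp1 : ~~ odd #|A| -> -1 \in A.
Proof. by move=> ev; apply: subgroup_mem; rewrite -signr_odd (negPf ev). Qed.

End Subgroup.

(** * Low coefficients of products over an arithmetic progression *)

Section ArithmeticProduct.
Variables (R : comNzRingType) (a b : R).

(** The reversal of the product of the [u + a + b i] for [0 < i <= N]: its [j]-th coefficient is the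
    [j]-th elementary symmetric function of the [a + b i]. *)
Definition ap_prod N : {poly R} := \prod_(i < N) (1 + (a + b * i.+1%:R) *: 'X).

Lemma ap_prodS N : ap_prod N.+1 = ap_prod N + (a + b * N.+1%:R) *: (ap_prod N * 'X).
Proof. by rewrite /ap_prod big_ord_recr /= mulrDr mulr1 scalerAr. Qed.

Lemma coef_ap_prodS N j :
  (ap_prod N.+1)`_j.+1 = (ap_prod N)`_j.+1 + (a + b * N.+1%:R) * (ap_prod N)`_j.
Proof. by rewrite ap_prodS coefD coefZ coefMX. Qed.

Lemma coef_ap_prod0 N : (ap_prod N)`_0 = 1.
Proof.
by rewrite coef0_prod big1 // => i _; rewrite coefD coef1 coefZ coefX mulr0 addr0.
Qed.

(** The factor 2, and then 24 and 48 below, clear denominators, so the closed forms hold over any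
    commutative ring by induction on [N]. *)
Lemma coef_ap_prod1 N (x := N%:R : R) :
  2%:R * (ap_prod N)`_1 = 2%:R * x * a + x * (x + 1) * b.
Proof.
rewrite /x; elim: N => [|N IH] in x *.
  by rewrite /ap_prod big_ord0 coef1 /=; ring.
by rewrite coef_ap_prodS coef_ap_prod0 mulrDr IH -!natr1; ring.
Qed.

Lemma coef_ap_prod2 N (x := N%:R : R) : 24%:R * (ap_prod N)`_2 =
  12%:R * x * (x - 1) * a ^+ 2 + 12%:R * (x - 1) * x * (x + 1) * (a * b)
  + x * (x + 1) * (x - 1) * (3%:R * x + 2%:R) * b ^+ 2.
Proof.
rewrite /x; elim: N => [|N IH] in x *.
  by rewrite /ap_prod big_ord0 coef1 /=; ring.
rewrite coef_ap_prodS mulrDr IH.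
have -> : 24%:R * ((a + b * N.+1%:R) * (ap_prod N)`_1)
   = 12%:R * (a + b * N.+1%:R) * (2%:R * (ap_prod N)`_1) by ring.
by rewrite coef_ap_prod1 -!natr1; ring.
Qed.

Lemma coef_ap_prod3 N (x := N%:R : R) : 48%:R * (ap_prod N)`_3 =
  8%:R * x * (x - 1) * (x - 2%:R) * a ^+ 3
  + 12%:R * (x - 1) * (x - 2%:R) * x * (x + 1) * a ^+ 2 * b
  + 2%:R * (x - 2%:R) * x * (x + 1) * (x - 1) * (3%:R * x + 2%:R) * a * b ^+ 2
  + x ^+ 2 * (x + 1) ^+ 2 * (x - 1) * (x - 2%:R) * b ^+ 3.
Proof.
rewrite /x; elim: N => [|N IH] in x *.
  by rewrite /ap_prod big_ord0 coef1 /=; ring.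
rewrite coef_ap_prodS mulrDr IH.
have -> : 48%:R * ((a + b * N.+1%:R) * (ap_prod N)`_2)
   = 2%:R * (a + b * N.+1%:R) * (24%:R * (ap_prod N)`_2) by ring.
by rewrite coef_ap_prod2 -!natr1; ring.
Qed.

Lemma size_ap_prod N : (size (ap_prod N) <= N.+1)%N.
Proof.
elim: N => [|N IH]; first by rewrite /ap_prod big_ord0 size_poly1.
rewrite ap_prodS (leq_trans (size_polyD _ _)) // geq_max (leq_trans IH) //=.
rewrite (leq_trans (size_scale_leq _ _)) // (leq_trans (size_polyMleq _ _)) //.
by rewrite size_polyX addnS addn1 ltnS.
Qed.

End ArithmeticProduct.

Lemma horner_ap_prodV (F : fieldType) (a b y : F) N : y != 0 ->
  (ap_prod a b N).[y^-1] = y^-1 ^+ N * \prod_(i < N) (y + (a + b * i.+1%:R)).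
Proof.
move=> y0; rewrite horner_prod -[N in _ ^+ N]card_ord -prodr_const -big_split /=.
by apply: eq_bigr => i _; rewrite !hornerE /=; field.
Qed.

(** [D] below has degree less than [n], a double zero at 0 and the [m = n - 2] further roots
    [1/(nk)], so it is zero. Its coefficient of degree 3 is nonetheless nonzero. *)
Lemma ap_prod_shift_false (F : fieldType) m (n := m.+2) :
  (1 < m)%N -> (forall k, (0 < k <= n.+1)%N -> k%:R != 0 :> F) ->
  ~ (forall k, (0 < k <= m)%N ->
       \prod_(i < n.-1) ((n * k)%:R + i.+1%:R) =
       \prod_(i < n.-1) ((n * k)%:R + (i.+1%:R - (n ^ 2)%:R)) :> F).
Proof.
move=> m1 nz prodE; have n0 : n%:R != 0 :> F by apply: nz; lia.
(* Polynomials in z = 1/u: the coefficients to compare become those of low degree. *)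
pose L : {poly F} := ap_prod 0 1 n.-1 - ap_prod (- (n ^ 2)%:R) 1 n.-1.
(* The scalar is the linear coefficient of [L], which makes [D] vanish to order 2 at 0; the
   subtracted product has the roots [1/(nk)]. *)
pose D := L - (n%:R ^+ 2 * (n%:R - 1)) *: (ap_prod 0 (- n%:R) m * 'X).
have D0 : D`_0 = 0.
  by rewrite !coefB !coef_ap_prod0 coefZ coefMX /=; ring.
have two0 : 2%:R != 0 :> F by apply: nz; lia.
have D1 : D`_1 = 0.
  apply: (mulfI two0); rewrite !coefB coefZ coefMX /= coef_ap_prod0 mulr0 !mulrBr.
  by rewrite !coef_ap_prod1 natrX /n /= -!natr1; ring.
have szD : (size D <= n)%N.
  rewrite !(leq_trans (size_polyD _ _)) // geq_max !size_polyN.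
  rewrite (leq_trans (size_polyD _ _)) ?geq_max ?size_polyN ?size_ap_prod //=.
  rewrite (leq_trans (size_scale_leq _ _)) // (leq_trans (size_polyMleq _ _)) //.
  by rewrite size_polyX addn2 /= ltnS size_ap_prod.
have DE : D = drop_poly 2 D * 'X^2.
  rewrite -{1}(poly_take_drop 2 D) [take_poly _ _](_ : _ = 0) ?add0r //.
  by apply/polyP => -[|[|i]]; rewrite coef_take_poly coef0.
have : drop_poly 2 D = 0.
  apply: (@roots_geq_poly_eq0 _ _ [seq (n * k)%:R^-1 | k <- iota 1 m]).
  - apply/allP => r /mapP[k]; rewrite mem_iota => /andP[k1 km] ->.
    have nk0 : (n * k)%:R != 0 :> F by rewrite natrM mulf_neq0 // nz //; lia.
    have: D.[(n * k)%:R^-1] = 0.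
      rewrite !hornerE !horner_ap_prodV //.
      have -> : \prod_(i < m) ((n * k)%:R + (0 + - n%:R * i.+1%:R)) = 0 :> F.
        have k'm : (k.-1 < m)%N by lia.
        apply/eqP/prodf_eq0; exists (Ordinal k'm) => //=.
        by rewrite prednK // natrM; apply/eqP; ring.
      have -> : \prod_(i < n.-1) ((n * k)%:R + (- (n ^ 2)%:R + 1 * i.+1%:R)) =
                \prod_(i < n.-1) ((n * k)%:R + (0 + 1 * i.+1%:R)) :> F.
        under [RHS]eq_bigr => i _ do rewrite add0r mul1r.
        rewrite prodE; last by lia.
        by apply: eq_bigr => i _; ring.
      by rewrite /=; ring.
    rewrite {1}DE hornerM hornerXn => /eqP; rewrite mulf_eq0 expf_eq0 /= invr_eq0.
    by rewrite (negPf nk0) orbF.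
  - rewrite map_inj_in_uniq ?iota_uniq // => /= k l.
    (* The points [1/(nk)] are distinct because a positive difference [j - i] is at most [m], hence
       nonzero in [F]. *)
    have kl_eq i j : (0 < j <= m)%N -> (i <= j)%N ->
        (n * i)%:R = (n * j)%:R :> F -> i = j.
      move=> jm ij; rewrite !natrM => /(mulfI n0) /eqP; rewrite eq_sym -subr_eq0.
      rewrite -natrB // => /eqP ji; apply/eqP; rewrite eqn_leq ij /= leqNgt.
      by apply/negP => lt; move/eqP: ji; apply/negP/nz; lia.
    rewrite !mem_iota => kI lI /invr_inj E.
    case/andP: kI lI => k1 km /andP[l1 lm].
    case: (leqP k l) => kl; [|apply/esym]; apply: kl_eq; rewrite ?E ?l1 ?k1 //.
    exact: ltnW.
  - by rewrite size_map size_iota size_drop_poly leq_subLR.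
move=> dD; have : D`_3 = 0 by rewrite DE dD mul0r coef0.
move/(congr1 ( *%R 48%:R)); rewrite mulr0 !coefB coefZ coefMX /= 2!mulrBr.
rewrite !coef_ap_prod3.
have -> : 48%:R * (n%:R ^+ 2 * (n%:R - 1) * (ap_prod 0 (- n%:R) m)`_2) =
   2%:R * n%:R ^+ 2 * (n%:R - 1) * (24%:R * (ap_prod 0 (- n%:R) m)`_2) :> F by ring.
rewrite coef_ap_prod2.
rewrite natrX.
have -> : m%:R = n%:R - 2%:R :> F by rewrite /n -!natr1; ring.
have -> : n.-1%:R = n%:R - 1 :> F by rewrite /n -!natr1; ring.
rewrite [LHS](_ : _ = 2%:R * n%:R ^+ 3 * (n%:R - 1) ^+ 2 * (n%:R - 2%:R) *
  (n%:R - 3%:R) * (n%:R + 1) ^+ 2); last by ring.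
have nB1 : n%:R - 1 != 0 :> F by rewrite /n -natr1 addrK nz //; lia.
have nD1 : n%:R + 1 != 0 :> F by rewrite natr1 nz //; lia.
by apply/eqP; rewrite !mulf_neq0 ?expf_neq0 // -natrB ?nz //; lia.
Qed.

(** * Binomial coefficients along a progression *)

Lemma natr_fact_neq0 (F : fieldType) N :
  (forall k, (0 < k <= N)%N -> k%:R != 0 :> F) -> N`!%:R != 0 :> F.
Proof.
elim: N => [|N IH] nz; first by rewrite oner_neq0.
rewrite factS natrM mulf_neq0 //; first by apply: nz; rewrite ltnSn.
by apply: IH => k /andP[k0 kN]; rewrite nz // k0 ltnW.
Qed.

Lemma natr_bin_neq0 (F : fieldType) N j :
  (forall k, (0 < k <= N)%N -> k%:R != 0 :> F) -> (j <= N)%N ->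
  'C(N, j)%:R != 0 :> F.
Proof.
move=> nz jN; have := natr_fact_neq0 nz.
by rewrite -(bin_fact jN) natrM mulf_eq0 negb_or => /andP[].
Qed.

(** The telescoped ratio of ['C(N, j + r)] to ['C(N, j)], free of division. When [j + r > N] both
    sides are zero, thanks to truncated subtraction. *)
Lemma bin_shift N j r :
  ('C(N, j + r) * \prod_(i < r) (j + i.+1) = 'C(N, j) * \prod_(i < r) (N - (j + i)))%N.
Proof.
elim: r => [|r IH]; first by rewrite !big_ord0 addn0.
rewrite !big_ord_recr /= !mulnA -IH !addnS mulnAC [('C(_, _.+1) * _)%N]mulnC.
by rewrite mul_bin_left -mulnA mulnC.
Qed.

(** Going from ['C(n^2 - 1, n k)] to ['C(n^2 - 1, n (k + 1))] takes [n] steps along the row. The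
    last one contributes [n (n - 1 - k) / (n (k + 1))], which is already the ratio of
    ['C(n - 1, k + 1)] to ['C(n - 1, k)]; the other [n - 1] steps must therefore contribute 1, which
    is the product identity refuted above. *)
Lemma binomial_progression_false (F : fieldType) m mu (n := m.+2) :
  (1 < m)%N -> odd n -> (forall k, (0 < k < n ^ 2)%N -> k%:R != 0 :> F) ->
  ~ (forall k, (0 < k < n)%N ->
       'C((n ^ 2).-1, n * k)%:R = mu * 'C(n.-1, k)%:R :> F).
Proof.
move=> m1 odd_n nz binE.
apply: (@ap_prod_shift_false F m) => // [k k_n|k /andP[k0 km]].
  by apply: nz; rewrite -/n in k_n *; nia.
have kn : (k < n)%N by rewrite /n; lia.
have nk_le : (n * k.+1 <= n * n.-1)%N by rewrite leq_pmul2l // /n; lia.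
have n2E : (n * n.-1 + n = n ^ 2)%N by rewrite /n -mulnn; lia.
have lt_n2 i : (i < n)%N -> (n * k + i < n ^ 2)%N.
  move: nk_le; rewrite mulnS -n2E; move: (n * k)%N (n * n.-1)%N => a b; lia.
rewrite -/n; set P := LHS; set Q := RHS.
have E : 'C((n ^ 2).-1, n * k.+1)%:R * (P * (n%:R * k.+1%:R)) =
         'C((n ^ 2).-1, n * k)%:R * (Q * (n%:R * (n.-1 - k)%:R)).
  have PE : P = \prod_(i < n.-1) (n * k + i.+1)%:R.
    by apply: eq_bigr => i _; rewrite natrD.
  have QE : Q = \prod_(i < n.-1) ((n ^ 2).-1 - (n * k + i))%:R.
    (* Reversing the sign of all [n - 1] factors costs nothing, since [n] is odd. *)
    transitivity (\prod_(i < n.-1) (- 1) *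
        \prod_(i < n.-1) ((n ^ 2)%:R - (n * k + i.+1)%:R) : F).
      by rewrite -big_split; apply: eq_bigr => i _; rewrite natrD /=; ring.
    rewrite prodr_const card_ord -signr_odd.
    have -> : odd n.-1 = false by move: odd_n; rewrite /n /= negbK => ->.
    rewrite mul1r; apply: eq_bigr => i _; have i_n := ltn_ord i.
    by rewrite -natrB ?addnS ?lt_n2 ?(leq_trans i_n) // subnS predn_sub.
  have B := congr1 (fun x => x%:R : F) (bin_shift (n ^ 2).-1 (n * k) n.-1).
  rewrite !natrM !natr_prod -PE -QE in B.
  have S := congr1 (fun x => x%:R : F) (mul_bin_left (n ^ 2).-1 (n * k + n.-1)).
  have nS : ((n * k + n.-1).+1 = n * k.+1)%N by rewrite mulnSr -addnS.
  have nB : ((n ^ 2).-1 - (n * k + n.-1) = n * (n.-1 - k))%N.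
    by rewrite -n2E mulnBr (addnS _ m.+1) subnDr.
  rewrite nS nB !natrM in S.
  transitivity (n%:R * k.+1%:R * 'C((n ^ 2).-1, n * k.+1)%:R * P); first by ring.
  by rewrite S -mulrA B; ring.
rewrite !binE ?k0 // in E.
have := congr1 (fun x => x%:R : F) (mul_bin_left n.-1 k).
rewrite /= !natrM => binS.
(* That [mu] is nonzero comes for free: [mu * 'C(n - 1, k)] is a binomial coefficient of a row below
   the characteristic bound. *)
have K : mu * 'C(n.-1, k)%:R * n%:R * (n.-1 - k)%:R != 0.
  rewrite -binE ?k0 //; apply: mulf_neq0; first apply: mulf_neq0.
  - apply: natr_bin_neq0 => [i i_n|]; first by apply: nz; nia.
    by move: (lt_n2 0%N isT); rewrite addn0; lia.
  - by apply: nz; rewrite /n; nia.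
  - by apply: nz; rewrite /n; nia.
apply: (mulfI K).
transitivity (mu * n%:R * ((n.-1 - k)%:R * 'C(n.-1, k)%:R) * P); first by ring.
rewrite -binS; transitivity (mu * 'C(n.-1, k.+1)%:R * (P * (n%:R * k.+1%:R))).
  by ring.
by rewrite E; ring.
Qed.

(** * The Stepanov polynomial *)

Lemma coef_CsubX_exp (R : comNzRingType) (a : R) N j :
  ((a%:P - 'X) ^+ N)`_j = (-1) ^+ j * a ^+ (N - j) * 'C(N, j)%:R.
Proof.
have -> : (a%:P - 'X) ^+ N =
    \poly_(i < N.+1) ((-1) ^+ i * a ^+ (N - i) * 'C(N, i)%:R).
  rewrite exprBn poly_def; apply: eq_bigr => i _.
  by rewrite -mul_polyC !rmorphM !rmorphXn /= rmorphN rmorph1 rmorph_nat; ring.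
rewrite coef_poly ltnS; case: leqP => // ltNj.
by rewrite bin_small // mulr0.
Qed.

Lemma dvdp_prod_XsubC_exp (F : fieldType) (s : seq F) e (f : {poly F}) :
  uniq s -> (forall b, b \in s -> ('X - b%:P) ^+ e %| f) ->
  \prod_(b <- s) ('X - b%:P) ^+ e %| f.
Proof.
elim: s => [|b s IH] /=; first by rewrite big_nil dvd1p.
case/andP => bs us fP; rewrite big_cons Gauss_dvdp.
  by rewrite fP ?mem_head // IH // => c cs; rewrite fP // inE cs orbT.
apply: coprimep_expl; rewrite coprimep_sym coprimep_XsubC.
rewrite rootE horner_prod; rewrite prodf_seq_neq0; apply/allP => c cs /=.
rewrite !hornerE expf_neq0 // subr_eq0; apply: contraNneq bs => ->.
exact: cs.
Qed.

Section Stepanov.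
Variables (F : finFieldType) (A : {set F}) (d : nat) (kappa : F).
Hypothesis sgA : is_mult_subgroup A.
Variable n : nat.
Hypothesis card_A : #|A| = n.
Hypothesis n_gt1 : (1 < n)%N.
Hypothesis diff_pow :
  forall a b, a \in A -> b \in A -> a != b -> (a - b) ^+ d = kappa.
Hypothesis char_large : forall k, (0 < k <= d + n.-1)%N -> k%:R != 0 :> F.

Let M := (d + n.-1)%N.

(** The weight [a] shifts the power sums so that those of degree above [d] vanish; the constant
    cancels the value taken at each point of [A]. *)
Definition stepanov_poly : {poly F} :=
  \sum_(a in A) a *: (a%:P - 'X) ^+ M - (n%:R * kappa)%:P.

Local Notation f := stepanov_poly.

Lemma coef_stepanov j : (0 < j <= M)%N ->
  f`_j = (-1) ^+ j * 'C(M, j)%:R * (if (n %| (M - j).+1)%N then n%:R else 0).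
Proof.
move=> /andP[j0 jM]; rewrite coefB coefC gtn_eqF // subr0 coef_sum.
under eq_bigr => a _ do rewrite coefZ coef_CsubX_exp.
rewrite -card_A -(subgroup_power_sum sgA) mulr_sumr; apply: eq_bigr => a _.
by rewrite exprS; ring.
Qed.

(** For [d < j <= M] the number [M - j + 1] lies strictly between 0 and [n], so [n] does not divide
    it. *)
Lemma size_stepanov : (size f <= d.+1)%N.
Proof.
apply/leq_sizeP => j dj; have [jM|Mj] := leqP j M.
  rewrite coef_stepanov ?(leq_ltn_trans _ dj) //.
  by rewrite gtnNdvd ?mulr0 // /M; lia.
rewrite coefB coefC gtn_eqF ?(leq_ltn_trans _ Mj) // subr0 coef_sum big1 // => a _.
by rewrite coefZ coef_CsubX_exp bin_small // !mulr0.
Qed.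

(** At degree [d] one has [M - d + 1 = n], so the coefficient is [n 'C(M, d)] up to sign. *)
Lemma stepanov_neq0 : (0 < d)%N -> f != 0.
Proof.
move=> d0; apply/eqP => /(congr1 (fun p : {poly F} => p`_d)) /eqP; apply/negP.
have dM : (d <= M)%N by exact: leq_addr.
rewrite coef0 coef_stepanov ?d0 // /M addKn prednK ?dvdnn; last exact: ltnW.
rewrite !mulf_neq0 ?signr_eq0 ?natr_bin_neq0 //.
by apply: char_large; lia.
Qed.

(** After expansion only power sums of exponents 1 to [k + 1 <= n] occur, and among these only
    exponent [n] gives a nonzero sum. *)
Lemma subgroup_shifted_power_sum b k : (0 < k < n)%N ->
  \sum_(a in A) a * (a - b) ^+ k = if k == n.-1 then n%:R else 0.
Proof.
case/andP => k0 kn; under eq_bigr => a _ do rewrite exprBn mulr_sumr.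
rewrite exchange_big /= big_ord_recl [X in _ + X]big1 ?addr0 => [|i _] /=.
  rewrite (eq_bigr (fun a => a ^+ k.+1)) => [|a _]; last first.
    by rewrite /= subn0 bin0 exprS; ring.
  rewrite subgroup_power_sum // card_A; case: eqP => [->|kn1].
    by rewrite prednK ?dvdnn // ltnW.
  by rewrite gtnNdvd //; lia.
rewrite (eq_bigr (fun a => (-1) ^+ lift ord0 i * b ^+ lift ord0 i *
    'C(k, lift ord0 i)%:R * a ^+ (k - lift ord0 i).+1)); last first.
  by move=> a _; rewrite exprS; ring.
rewrite -mulr_sumr subgroup_power_sum // card_A gtnNdvd ?mulr0 //.
by rewrite lift0; have := ltn_ord i; lia.
Qed.

(** In the Taylor expansion at [b], the coefficient of order [i < n - 1] involves
    [(a - b)^(d + (n - 1 - i))]. Replacing the [d]-th power by [kappa] leaves a shifted power sum,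
    which is zero unless [i = 0]; there the constant term of [f] cancels it. *)
Lemma dvdp_stepanov b : b \in A -> ('X - b%:P) ^+ n.-1 %| f.
Proof.
move=> Ab.
have -> : f = \sum_(i < M.+1) ((-1) ^+ i * 'C(M, i)%:R *
     \sum_(a in A) a * (a - b) ^+ (M - i)) *: ('X - b%:P) ^+ i - (n%:R * kappa)%:P.
  congr (_ - _).
  under [RHS]eq_bigr => i _ do rewrite mulr_sumr scaler_suml.
  rewrite exchange_big /=; apply: eq_bigr => a _.
  rewrite (_ : a%:P - 'X = (a - b)%:P - ('X - b%:P)); last by rewrite rmorphB; ring.
  rewrite exprBn scaler_sumr; apply: eq_bigr => i _.
  rewrite -!mul_polyC !rmorphM !rmorphXn /= rmorphN rmorph1 rmorph_nat; ring.
have sum_small i : (i < n.-1)%N ->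
    \sum_(a in A) a * (a - b) ^+ (M - i) = if i == 0%N then n%:R * kappa else 0.
  move=> i_n; have -> : (M - i = d + (n.-1 - i))%N by rewrite /M addnBA // ltnW.
  rewrite (eq_bigr (fun a => kappa * (a * (a - b) ^+ (n.-1 - i)))) => [|a Aa].
    rewrite -mulr_sumr subgroup_shifted_power_sum; last by lia.
    have -> : (n.-1 - i == n.-1)%N = (i == 0%N) by lia.
    by case: ifP => _; rewrite ?mulr0 // mulrC.
  have [->|ab] := eqVneq a b; last by rewrite exprD diff_pow //; ring.
  (* The term [a = b] is zero on both sides because [n - 1 - i] is still positive. *)
  by rewrite subrr !expr0n !gtn_eqF ?mulr0 //; lia.
have n1M : (n.-1 <= M)%N by exact: leq_addl.
rewrite big_ord_recl /= expr0 bin0 !mul1r (sum_small 0%N); last by lia.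
rewrite eqxx alg_polyC [X in _ %| X]addrC addKr.
apply: (big_ind (fun p => ('X - b%:P) ^+ n.-1 %| p)) => [|p q|i _];
  [exact: dvdp0 | exact: dvdp_add | ].
rewrite /bump /= add1n; have [i_n|n_i] := ltnP i.+1 n.-1.
  by rewrite sum_small // mulr0 scale0r dvdp0.
by rewrite -mul_polyC dvdp_mull // dvdp_exp2l.
Qed.

Lemma dvdp_stepanov_full : ('X^n - 1) ^+ n.-1 %| f.
Proof.
rewrite -card_A (subgroup_prod_XsubC sgA) card_A -big_enum /= -prodrXl.
apply: dvdp_prod_XsubC_exp; first exact: enum_uniq.
by move=> b; rewrite mem_enum; exact: dvdp_stepanov.
Qed.

Lemma size_Xn_sub1_exp : size (('X^n - 1 : {poly F}) ^+ n.-1) = (n * n.-1).+1.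
Proof.
have n0 : (0 < n)%N by exact: ltnW.
have X0 : 'X^n - 1 != 0 :> {poly F} by rewrite -size_poly_gt0 size_Xn_sub_1.
rewrite -[LHS]prednK ?size_poly_gt0 ?expf_neq0 //.
by rewrite size_exp size_Xn_sub_1.
Qed.

Lemma stepanov_bound : (0 < d)%N -> (n * n.-1 <= d)%N.
Proof.
move=> d0; rewrite -ltnS -size_Xn_sub1_exp.
exact: leq_trans (dvdp_leq (stepanov_neq0 d0) dvdp_stepanov_full) size_stepanov.
Qed.

Lemma stepanov_equality : d = (n * n.-1)%N -> odd n ->
  exists mu, forall k, (0 < k < n)%N ->
    'C((n ^ 2).-1, n * k)%:R = mu * 'C(n.-1, k)%:R :> F.
Proof.
move=> dE odd_n; have d0 : (0 < d)%N by rewrite dE; lia.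
have n0 : n%:R != 0 :> F by apply: char_large; rewrite dE; nia.
have : ('X^n - 1) ^+ n.-1 %= f.
  rewrite -dvdp_size_eqp ?dvdp_stepanov_full // eqn_leq.
  rewrite (dvdp_leq (stepanov_neq0 d0) dvdp_stepanov_full) size_Xn_sub1_exp.
  by rewrite -dE size_stepanov.
case/eqpP => -[c1 c2] /= /andP[c1_0 c2_0] E.
(* Here [c1] and [c2] are the proportionality constants, and [n] is the power sum in the
   coefficients of [f]. The signs [(-1)^k] and [(-1)^(n k)] agree as [n] is odd. *)
exists (c1 / (c2 * n%:R)) => k /andP[k0 kn].
have M2 : M = (n ^ 2).-1 by rewrite /M dE -mulnn; nia.
have := congr1 (fun p : {poly F} => p`_(n * k)) E.
rewrite !coefZ coef_stepanov; last by rewrite M2 -mulnn; nia.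
have -> : (n %| (M - n * k).+1)%N.
  by rewrite (_ : (M - n * k).+1 = n * (n - k))%N ?dvdn_mulr // M2 -mulnn; nia.
have -> : (('X^n - 1) ^+ n.-1)`_(n * k) = (-1) ^+ k * 'C(n.-1, k)%:R :> F.
  have -> : ('X^n - 1) ^+ n.-1 = ((1%:P - 'X) ^+ n.-1) \Po 'X^n :> {poly F}.
    rewrite rmorphXn /= rmorphB /= comp_polyC comp_polyX -opprB exprNn -signr_odd.
    by rewrite (_ : odd n.-1 = false) ?mul1r //; lia.
  rewrite coef_comp_poly_Xn ?dvdn_mulr // ?mulKn; try by exact: ltnW.
  by rewrite coef_CsubX_exp expr1n mulr1.
rewrite -M2 -(signr_odd _ (n * k)) oddM odd_n -(signr_odd _ k) => Ek.
have sk : (-1) ^+ odd k != 0 :> F by rewrite signr_eq0.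
apply: (mulfI (mulf_neq0 c2_0 n0)); apply: (mulfI sk).
transitivity (c2 * ((-1) ^+ odd k * 'C(M, n * k)%:R * n%:R)); first by ring.
by rewrite -Ek; field; rewrite n0.
Qed.

End Stepanov.

(** * Counting differences and bounding [Gam] *)

Section DifferenceSet.
Variables (F : finFieldType) (A Gam : {set F}) (xi : F) (c : nat).
Hypotheses (sgA : is_mult_subgroup A) (sgG : is_mult_subgroup Gam).
Hypothesis xi0 : xi != 0.
Hypothesis diffA : diffset A = dilate xi Gam :|: [set 0].
Hypothesis convA : forall x, x \in dilate xi Gam -> conv A x = c.

Lemma sum_conv (B : {set F}) : (\sum_x conv B x = #|B| * #|B|)%N.
Proof.
transitivity (\sum_x \sum_(y in B) ((y + x)%R \in B))%N.
  apply: eq_bigr => x _; rewrite /conv -sum1dep_card big_mkcondr /=.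
  by apply: eq_bigr => y _; case: (_ \in _).
rewrite exchange_big -sum_nat_const; apply: eq_bigr => y _ /=.
rewrite (reindex_onto (fun x => x - y) (fun x => y + x)) /= => [|x _]; last first.
  by rewrite addrC addKr.
rewrite -sum1_card [RHS]big_mkcond /=.
by apply: eq_big => x; rewrite addrC subrK ?eqxx // => _; case: (_ \in _).
Qed.

Lemma card_dilate : #|dilate xi Gam| = #|Gam|.
Proof. by rewrite card_imset //; exact: mulfI. Qed.

Lemma dilate_neq0 x : x \in dilate xi Gam -> x != 0.
Proof. by case/imsetP => g Gg ->; rewrite mulf_neq0 // (subgroup_neq0 sgG Gg). Qed.

Lemma sub_dilate a b : a \in A -> b \in A -> a != b -> a - b \in dilate xi Gam.
Proof.
move=> Aa Ab ab; have : a - b \in diffset A by apply/imset2P; exists a b.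
by rewrite diffA !inE subr_eq0 (negPf ab) orbF.
Qed.

(** Sum [conv A] over the field: 0 contributes [#|A|], each point of the dilate contributes [c], and
    all other points contribute nothing. *)
Lemma card_sqr_sub : (#|A| * #|A| - #|A| = c * #|Gam|)%N.
Proof.
rewrite -sum_conv (bigD1 0) //=.
have -> : conv A 0 = #|A|.
  by rewrite /conv; apply: eq_card => y; rewrite !inE addr0 andbb.
rewrite addKn (bigID (mem (dilate xi Gam))) /= [X in (_ + X)%N]big1 ?addn0.
  rewrite -card_dilate mulnC -sum_nat_const; apply: eq_big => [x|x /andP[_]].
    by rewrite andb_idl //; exact: dilate_neq0.
  exact: convA.
move=> x /andP[x0 xD]; apply/eqP; rewrite cards_eq0; apply/eqP/setP => y.
rewrite !inE; apply/negP => /andP[Ay Ayx]; case/negP: xD.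
by rewrite -(addKr y x) addrC sub_dilate // -subr_eq0 addrAC subrr add0r.
Qed.

Lemma card_A_gt1 : (1 < #|A|)%N.
Proof.
have xiD : xi \in dilate xi Gam.
  by apply/imsetP; exists 1; rewrite ?mulr1 // subgroup1.
have : xi \in diffset A by rewrite diffA inE xiD.
case/imset2P => a b Aa Ab E; apply/card_gt1P; exists a, b; split => //.
by rewrite -subr_eq0 -E.
Qed.

(** The map [a - 1] embeds [A] in its difference set. This bound later keeps [d + n - 1] below the
    characteristic. *)
Lemma card_A_le : (#|A| <= #|Gam|.+1)%N.
Proof.
rewrite -(card_imset A (addIr (-1))).
have -> : #|Gam|.+1 = #|diffset A|.
  have D0 : 0 \notin dilate xi Gam.
    by apply/negP => /dilate_neq0; rewrite eqxx.
  by rewrite diffA setUC cardsU1 card_dilate D0.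
apply/subset_leq_card/subsetP => _ /imsetP[a Aa ->].
by apply/imset2P; exists a 1; rewrite ?subgroup1.
Qed.

Lemma sub_pow a b : a \in A -> b \in A -> a != b -> (a - b) ^+ #|Gam| = xi ^+ #|Gam|.
Proof.
move=> Aa Ab /(sub_dilate Aa Ab)/imsetP[g Gg ->].
by rewrite exprMn (subgroup_expg sgG Gg) mulr1.
Qed.

(** For [a] in [A] other than 1 and -1, the difference [1 - a] has the second representation
    [(-a) - (-1)]. *)
Lemma conv_gt1 : -1 \in A -> (2 < #|A|)%N -> (1 < c)%N.
Proof.
move=> A_1 A3; have [a Aa] : exists2 a, a \in A & a \notin [set 1; -1].
  apply/subsetPn; apply: contraL A3 => /subset_leq_card le.
  by rewrite -leqNgt (leq_trans le) // cards2; case: eqP.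
rewrite !inE negb_or => /andP[a1 aN1].
have A1 := subgroup1 sgA.
rewrite -(convA (sub_dilate A1 Aa _)) 1?eq_sym //.
apply/card_gt1P; exists a, (-1); split => //; rewrite !inE ?Aa ?A_1 /=.
- by rewrite addrC subrK.
- by rewrite addKr -mulN1r subgroupM.
Qed.

Lemma card_Gam_dichotomy :
  (forall k, (0 < k < #|F|)%N -> k%:R != 0 :> F) ->
  (#|Gam| <= 6)%N \/ #|Gam| = #|F|.-1.
Proof.
move=> charF; have n_gt1 := card_A_gt1; have n_le := card_A_le.
have d_gt0 := card_subgroup_gt0 sgG; have cardE := card_sqr_sub.
have F_gt1 : (1 < #|F|)%N := finNzRing_gt1 F.
have /dvdnP[q qE] := card_subgroup_dvd sgG.
have powA := sub_pow; have conv_gt1 := conv_gt1.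
move: n_gt1 n_le d_gt0 cardE qE powA conv_gt1 F_gt1 charF.
set n := #|A|; set d := #|Gam|; move: (erefl n) (erefl d); rewrite {1}/n {1}/d.
move: n d => n d cardA _; move: #|F| => r.
move=> n_gt1 n_le d_gt0 cardE qE powA conv_gt1 r_gt1 charF.
(* [q] is the index of [Gam]. If it is at least 2, then [2 d <= r - 1], and [n - 1 <= d] gives
   [d + n - 1 < r]. *)
have [q1|q2] := leqP q 1.
  by right; case: q qE q1 => [|[|q]] //; lia.
left; have dr : (2 * d <= r.-1)%N by rewrite qE leq_mul2r q2 orbT.
have char_large k : (0 < k <= d + n.-1)%N -> k%:R != 0 :> F.
  by move=> kM; apply: charF; lia.
have le := stepanov_bound sgA cardA n_gt1 powA char_large d_gt0.
have nnE : (n * n.-1 = c * d)%N by rewrite -cardE -subn1 mulnBr muln1.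
(* Stepanov's bound reads [c d <= d], while [c d = n (n - 1)] is positive. *)
have c1 : c = 1%N by nia.
have dE : d = (n * n.-1)%N by rewrite nnE c1 mul1n.
have [n3|n3] := leqP n 3; first by nia.
have odd_n : odd n.
  apply/negPn/negP; rewrite -{1}cardA => /(subgroup_opp1 sgA)/conv_gt1.
  by rewrite c1; lia.
have [mu muE] := stepanov_equality sgA cardA n_gt1 powA char_large dE odd_n.
have nE : n = n.-2.+2 by lia.
case: (@binomial_progression_false F n.-2 mu); rewrite -?nE //; first by lia.
by move=> k k_n; apply: char_large; rewrite dE; nia.
Qed.

End DifferenceSet.

(** The constant 1/4 is the product of two halves: [ln p >= ln 2 > 1/2] and [p - 1 >= p/2]. It
    serves the case where [Gam] is the whole group. *)
Lemma p_over_log_bound (p : nat) : (1 < p)%N ->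
  Rle (Rdiv (Rmult (/ 4) (INR p)) (ln (INR p))) (INR p.-1).
Proof.
move=> p_gt1; have p2 : Rle 2 (INR p).
  by rewrite -[IZR 2]/(IZR (Z.of_nat 2)) -INR_IZR_INZ; apply: le_INR; apply/leP.
have pE : INR p = Rplus (INR p.-1) 1 by rewrite -S_INR prednK // ltnW.
have lnp : Rle (ln 2) (ln (INR p)).
  by case: p2 => [lt|<-]; [left; apply: ln_increasing; lra | right].
have ln2 := ln_lt_2.
apply: (Rmult_le_reg_r (ln (INR p))); first by lra.
rewrite /Rdiv Rmult_assoc Rinv_l; last by lra.
by nra.
Qed.

Theorem theorem4 :
  exists (C : nat) (c0 : R), Rlt R0 c0 /\
  forall (p : nat), prime p ->
  forall (A Gam : {set 'F_p}) (xi : 'F_p) (c : nat),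
    is_mult_subgroup A -> is_mult_subgroup Gam ->
    xi != 0 ->
    diffset A = dilate xi Gam :|: [set 0] ->
    (forall x, x \in dilate xi Gam -> conv A x = c) ->
    (#|A| * #|A| - #|A| = c * #|Gam|)%nat /\
    ((#|Gam| <= C)%nat \/ Rle (Rdiv (Rmult c0 (INR p)) (ln (INR p))) (INR #|Gam|)).
Proof.
exists 6%N, (Rinv 4); split; first by lra.
move=> p p_pr A Gam xi c sgA sgG xi0 diffA convA; split.
  exact: card_sqr_sub sgG xi0 diffA convA.
case: (card_Gam_dichotomy sgA sgG xi0 diffA convA) => [k||->]; last 1 first.
- by right; rewrite card_Fp //; apply: p_over_log_bound; exact: prime_gt1.
- rewrite card_Fp // => /andP[k0 kp].
  by rewrite -(dvdn_pcharf (pchar_Fp p_pr)) gtnNdvd.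
- by left.
Qed.
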